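(* Let $r\ge2$ and let $U$ be a real strictly lower triangular $r\times r$ matrix (zero on and above the diagonal). Then there exist an affine Osserman manifold $(M,D)$ of dimension $r+1$, a point $Q$ of the zero section $Z(N)$ of $N=T^*M$, and vectors $\xi_1,\xi_2\in S^+(T_QN,g_N)$, where $g_N$ is the modified Riemannian extension metric on $N$, such that: (1) ${}^{g_N}\mathcal{J}(\xi_1)$ is diagonalizable. (2) Relative to a suitable basis of $T_QN$, $${}^{g_N}\mathcal{J}(\xi_2)=0\cdot\mathrm{Id}_1\oplus1\cdot\mathrm{Id}_1\oplus(\tfrac14\cdot\mathrm{Id}_r+U)\oplus(\tfrac14\cdot\mathrm{Id}_r+U^t).$$
   Context: An affine manifold $(M,D)$ is a smooth manifold $M$ with a torsion-free connection $D$ on $TM$. Curvature: ${}^DR(X,Y)=D_XD_Y-D_YD_X-D_{[X,Y]}$. Jacobi operator: ${}^D\mathcal{J}(X):Y\mapsto {}^DR(Y,X)X$. $(M,D)$ is affine Osserman if ${}^D\mathcal{J}(X)$ is nilpotent for every tangent vector $X$. For a pseudo-Riemannian metric $g$, ${}^gR$ (of the Levi-Civita connection) has the same sign convention, ${}^g\mathcal{J}(X):Y\mapsto {}^gR(Y,X)X$, and $S^+(T_QN,g)=\{\xi\in T_QN:g(\xi,\xi)=1\}$. Modified Riemannian extension: let $N=T^*M$, $n=\dim M$. Local coordinates $(x_1,\dots,x_n)$ on $M$ induce coordinates $(x_1,\dots,x_n,x_{1'},\dots,x_{n'})$ on $N$ by writing a 1-form as $\omega=x_{i'}dx^i$ (Einstein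 summation). Write $D_{\partial_{x_i}}\partial_{x_j}={}^D\Gamma_{ij}{}^k\partial_{x_k}$ and $u\circ v=\frac12(u\otimes v+v\otimes u)$. Then $g_N$ is the (globally well-defined) metric of neutral signature $(n,n)$ on $N$ given locally by $g_N=2\,dx^i\circ dx^{i'}+\{x_{i'}x_{j'}-2x_{k'}{}^D\Gamma_{ij}{}^k\}dx^i\circ dx^j$. *)

(* Defs.v *)
From HB Require Import structures.
From mathcomp Require Import all_boot all_order all_algebra.
From mathcomp Require Import all_classical all_reals all_analysis.

Set Implicit Arguments.
Unset Strict Implicit.
Unset Printing Implicit Defensive.

Import Order.TTheory GRing.Theory Num.Theory.
Import numFieldNormedType.Exports.

Local Open Scope classical_set_scope.
Local Open Scope ring_scope.

(* Meaningful for open O only: derivatives are taken in the ambient space. *)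
Fixpoint Ck (R : realType) (m : nat) (W : normedModType R) (k : nat)
    (O : set 'rV[R]_m) (f : 'rV[R]_m -> W) : Prop :=
  (forall x, O x -> {for x, continuous f}) /\
  match k with
  | 0 => True
  | k'.+1 => forall v : 'rV[R]_m,
      (forall x, O x -> derivable f x v) /\ Ck k' O (fun x => 'D_v f x)
  end.

Definition smooth_on (R : realType) (m : nat) (W : normedModType R)
    (O : set 'rV[R]_m) (f : 'rV[R]_m -> W) : Prop :=
  forall k, Ck k O f.

(* A smooth manifold, given by a smooth (not necessarily maximal) atlas.  The
   maps [chart a] and [chart_inv a] are total functions; only their values on
   [chart_dom a] and on its image [chart_codom a] are relevant. *)
Record manifold (R : realType) (n : nat) := Manifold {
  points :> topologicalType;
  atlas : Type;
  chart_dom : atlas -> set points;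
  chart : atlas -> points -> 'rV[R]_n;
  chart_inv : atlas -> 'rV[R]_n -> points;
  chart_codom : atlas -> set 'rV[R]_n := fun a => chart a @` chart_dom a;
  manifold_hausdorff : hausdorff_space points;
  manifold_second_countable : @second_countable points;
  chart_cover : forall p, exists a, chart_dom a p;
  chart_dom_open : forall a, open (chart_dom a);
  chart_codom_open : forall a, open (chart_codom a);
  chartK : forall a p, chart_dom a p -> chart_inv a (chart a p) = p;
  chart_continuous : forall a p,
    chart_dom a p -> {for p, continuous (chart a)};
  chart_inv_continuous : forall a x,
    chart_codom a x -> {for x, continuous (chart_inv a)};
  transition_smooth : forall a b,
    smooth_on (chart a @` (chart_dom a `&` chart_dom b))
              (chart b \o chart_inv a)
}.

Definition transition (R : realType) (n : nat) (M : manifold R n)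
    (a b : atlas M) : 'rV[R]_n -> 'rV[R]_n := chart b \o chart_inv a.

(* Christoffel symbols in one coordinate system: [G x i j k] is Gamma_ij^k at
   the point with coordinates x, i.e. D_(d_i) d_j = Gamma_ij^k d_k. *)
Definition christoffel (R : realType) (n : nat) : Type :=
  'rV[R]_n -> 'I_n -> 'I_n -> 'I_n -> R.

Definition christoffel_app (R : realType) (n : nat) (G : christoffel R n)
    (x u v : 'rV[R]_n) : 'rV[R]_n :=
  \row_k \sum_i \sum_j u 0 i * v 0 j * G x i j k.

(* A torsion-free connection on TM, as a family of Christoffel symbols, one for
   each chart.  [conn_transition] is the change of coordinates rule
     dt (Gamma^a(u, v)) = d^2 t (u, v) + Gamma^b (dt u, dt v),
   where t is the transition map from chart a to chart b. *)
Record torsion_free_connection (R : realType) (n : nat) (M : manifold R n) :=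
  TorsionFreeConnection {
  Gamma :> atlas M -> christoffel R n;
  conn_smooth : forall a i j k,
    smooth_on (chart_codom a) (fun x => Gamma a x i j k);
  conn_torsion_free : forall a x i j k,
    chart_codom a x -> Gamma a x i j k = Gamma a x j i k;
  conn_transition : forall (a b : atlas M) (p : M),
    chart_dom a p -> chart_dom b p ->
    let t := transition a b in let x := chart a p in
    forall u v : 'rV[R]_n,
      'D_(christoffel_app (Gamma a) x u v) t x =
      'D_u (fun y => 'D_v t y) x
      + christoffel_app (Gamma b) (chart b p) ('D_u t x) ('D_v t x)
}.

(* Vector fields on a coordinate domain are maps 'rV_n -> 'rV_n, giving the
   components with respect to the coordinate frame. *)
Definition cov_deriv (R : realType) (n : nat) (G : christoffel R n)
    (X Y : 'rV[R]_n -> 'rV[R]_n) : 'rV[R]_n -> 'rV[R]_n :=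
  fun x => 'D_(X x) Y x + christoffel_app G x (X x) (Y x).

Definition lie_bracket (R : realType) (n : nat)
    (X Y : 'rV[R]_n -> 'rV[R]_n) : 'rV[R]_n -> 'rV[R]_n :=
  fun x => 'D_(X x) Y x - 'D_(Y x) X x.

Definition curvature (R : realType) (n : nat) (G : christoffel R n)
    (X Y Z : 'rV[R]_n -> 'rV[R]_n) : 'rV[R]_n -> 'rV[R]_n :=
  fun x => cov_deriv G X (cov_deriv G Y Z) x
         - cov_deriv G Y (cov_deriv G X Z) x
         - cov_deriv G (lie_bracket X Y) Z x.

(* The curvature is tensorial: tangent vectors at x are extended to vector
   fields with constant components. *)
Definition curvature_at (R : realType) (n : nat) (G : christoffel R n)
    (x u v w : 'rV[R]_n) : 'rV[R]_n :=
  curvature G (cst u) (cst v) (cst w) x.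

Definition jacobi (R : realType) (n : nat) (G : christoffel R n)
    (x xi : 'rV[R]_n) : 'rV[R]_n -> 'rV[R]_n :=
  fun eta => curvature_at G x eta xi xi.

Definition nilpotent_op (R : realType) (n : nat)
    (f : 'rV[R]_n -> 'rV[R]_n) : Prop :=
  exists m : nat, forall v, iter m f v = 0.

Definition affine_osserman (R : realType) (n : nat) (M : manifold R n)
    (D : torsion_free_connection M) : Prop :=
  forall (a : atlas M) (p : M), chart_dom a p ->
  forall X : 'rV[R]_n, nilpotent_op (jacobi (D a) (chart a p) X).

Definition partial (R : realType) (m : nat) (i : 'I_m)
    (f : 'rV[R]_m -> R) (z : 'rV[R]_m) : R :=
  'D_(delta_mx 0 i) f z.

(* The metric is given by its Gram matrix in the coordinate frame. *)
Definition levi_civita (R : realType) (m : nat) (g : 'rV[R]_m -> 'M[R]_m) :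
    christoffel R m :=
  fun z i j k => 2^-1 * \sum_l invmx (g z) k l *
    (partial i (fun y => g y j l) z + partial j (fun y => g y i l) z
     - partial l (fun y => g y i j) z).

(* Coordinates on T*M induced by a chart of M: the first n components of z are
   x_1 .. x_n, the last n are x_1' .. x_n'.  Since
   2 dx^i o dx^i' = dx^i (x) dx^i' + dx^i' (x) dx^i and the coefficients of
   dx^i o dx^j are symmetric in i, j (the connection is torsion-free), the Gram
   matrix of g_N has the following blocks. *)
Definition riemannian_extension (R : realType) (n : nat) (G : christoffel R n)
    (z : 'rV[R]_(n + n)) : 'M[R]_(n + n) :=
  let x := lsubmx z in let x' := rsubmx z in
  block_mx
    (\matrix_(i, j)
       (x' 0 i * x' 0 j - 2 * \sum_k x' 0 k * G x i j k)) 1%:M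
    1%:M                                                  0.

(* Induced coordinates of the zero covector at p. *)
Definition zero_section (R : realType) (n : nat) (M : manifold R n)
    (a : atlas M) (p : M) : 'rV[R]_(n + n) := row_mx (chart a p) 0.

Definition unit_spacelike (R : realType) (m : nat) (g : 'rV[R]_m -> 'M[R]_m)
    (z : 'rV[R]_m) : set 'rV[R]_m :=
  [set xi | \sum_i \sum_j g z i j * xi 0 i * xi 0 j = 1].

(* e is a basis of the space of row vectors, and A is the matrix of f with
   respect to e, with the images of the basis vectors as columns. *)
Definition represented_by (R : realType) (m N : nat) (e : 'I_m -> 'rV[R]_N)
    (f : 'rV[R]_N -> 'rV[R]_N) (A : 'M[R]_m) : Prop :=
  [/\ row_free (\matrix_i e i), row_full (\matrix_i e i) &
      forall j, f (e j) = \sum_i A i j *: e i].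

Definition diagonalizable_op (R : realType) (N : nat)
    (f : 'rV[R]_N -> 'rV[R]_N) : Prop :=
  exists (e : 'I_N -> 'rV[R]_N) (d : 'rV[R]_N), represented_by e f (diag_mx d).

Definition block4_mx (R : realType) (m1 m2 m3 m4 : nat) (A1 : 'M[R]_m1)
    (A2 : 'M[R]_m2) (A3 : 'M[R]_m3) (A4 : 'M[R]_m4) :
    'M[R]_(m1 + (m2 + (m3 + m4))) :=
  block_mx A1 0 0 (block_mx A2 0 0 (block_mx A3 0 0 A4)).

(* Main.v *)
(** On R^(r+1) take the connection whose only nonzero Christoffel symbols are
    Gamma_00^k = (x B)_k, where B = [[0, 0], [0, U^t]].  Its Jacobi operator is
    J(X) Y = X_0 (X_0 (Y B) - Y_0 (X B)), which is nilpotent because B is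
    strictly triangular.  As these symbols are linear in x, the Gram matrix of
    g_N is a constant plus a quadratic form, so the Levi-Civita connection
    vanishes at the origin Q of T*M and the curvature at Q is read off from the
    second derivatives of g_N.  For xi = (e_k, e_k / 2) this gives J(xi) xi = 0
    and J(xi) (2 e_k, - e_k) = (2 e_k, - e_k), and on the remaining coordinate
    vectors J(xi) is 1/4 Id if k <> 0, and 1/4 Id plus the action of
    B on x and of B^t on x' if k = 0. *)

From HB Require Import structures.
Require Import Defs.
From mathcomp Require Import all_boot all_order all_algebra.
From mathcomp Require Import all_classical all_reals all_analysis.
From mathcomp Require Import ring.
Import Order.TTheory GRing.Theory Num.Theory.
Import numFieldNormedType.Exports.
Set Implicit Arguments.
Unset Strict Implicit.
Unset Printing Implicit Defensive.
Local Open Scope classical_set_scope.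
Local Open Scope ring_scope.

(** * Differentiation along lines *)

(** The difference quotient is A + h B + h^2 C, which tends to A. Degree 3 covers every use: along
    lines [corner_conn] is affine and the Gram matrix of g_N quadratic, and on lines through the
    origin the Levi-Civita symbols are cubic. *)
Lemma is_derive_cubic (R : realType) (V W : normedModType R) (f : V -> W)
    (x v : V) (A B C : W) :
  (forall h : R, f (h *: v + x) = f x + h *: A + h ^+ 2 *: B + h ^+ 3 *: C) ->
  is_derive x v f A.
Proof.
move=> fE.
have cvgA : (fun h : R => h^-1 *: ((f \o shift x) (h *: v) - f x)) @ 0^' --> A.
  apply: (@cvg_trans _ ((fun h : R => A + h *: B + (h * h) *: C) @ 0^')).
    apply: near_eq_cvg; near=> h.
    have h0 : h != 0 by near: h; exact: nbhs_dnbhs_neq.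
    rewrite /= fE [_ - f x]addrC !addrA addNr add0r !scalerDr !scalerA mulVf// scale1r.
    by rewrite !exprS expr0 mulr1 !mulKf.
  suff : (fun h : R => A + h *: B + (h * h) *: C) @ 0^' --> A + 0 *: B + (0 * 0) *: C.
    by rewrite mulr0 !scale0r !addr0.
  have id0 : (fun h : R => h) @ 0^' --> (0 : R) by apply: cvg_within.
  apply: cvgD; first apply: cvgD.
  - exact: cvg_cst.
  - exact: cvgZr_tmp.
  - by apply: cvgZr_tmp; exact: cvgM.
split; first by apply/cvg_ex; exists A.
exact: cvg_lim cvgA.
Unshelve. all: by end_near. Qed.

Lemma is_derive_linear (R : realType) (V W : normedModType R)
    (f : {linear V -> W}) (x v : V) : is_derive x v f (f v).
Proof.
apply: (@is_derive_cubic _ _ _ _ _ _ _ 0 0) => h.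
by rewrite linearD linearZ !scaler0 !addr0 addrC.
Qed.

(** * Topology of R^n and smoothness of linear maps *)

(** A countable base is given by the balls with rational centre and radius 1/(m+1). *)
Lemma second_countable_rV (R : realType) n :
  @second_countable 'rV[R]_n.
Proof.
pose b (q : 'rV[rat]_n * nat) : set 'rV[R]_n :=
  ball (map_mx ratr q.1 : 'rV[R]_n) (q.2.+1%:R^-1).
exists (range b); first exact: card_le_trans (card_image_le _ _) (countableP _).
split; first by move=> _ [q _ <-]; apply: ball_open; rewrite invr_gt0.
move=> x V /nbhs_ballP[e /= e0 eV].
(* With 1/(m+1) < e/2, a ball of that radius whose rational centre is that close to x stays inside
   the ball of radius e around x. *)
have [m me] := ltr_add_invr (divr_gt0 e0 (ltr0n R 2)).
rewrite add0r in me.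
have m0 : (0 : R) < m.+1%:R^-1 by rewrite invr_gt0.
have /choice[q qP] : forall i : 'I_n, exists q : rat,
    ball (x ord0 i) m.+1%:R^-1 (ratr q : R).
  move=> i; have [||y [xy [q _ qy]]] := @dense_rat R (ball (x ord0 i) m.+1%:R^-1).
  - by exists (x ord0 i); exact: ballxx.
  - exact: ball_open.
  - by exists q; rewrite qy.
pose Q : 'rV[rat]_n := \row_i q i.
have xQ : ball x m.+1%:R^-1 (map_mx ratr Q : 'rV[R]_n).
  by split=> // i j; rewrite !mxE ord1; exact: qP.
exists (b (Q, m)) => /=; first by split; [exists (Q, m)|exact/ball_sym].
move=> y /= Qy; apply: eV; rewrite (splitr e).
apply: le_ball (ball_triangle xQ Qy).
by rewrite lerD// ltW.
Qed.

Lemma Ck_cst (R : realType) m (W : normedModType R) k (O : set 'rV[R]_m) (c : W) :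
  Ck k O (fun=> c).
Proof.
elim: k c => [|k IHk] c; split=> //; try by move=> x _; exact: cst_continuous.
move=> v; split; first by move=> x _; exact: derivable_cst.
have -> : (fun x => 'D_v (fun=> c) x) = (fun=> 0 : W).
  by apply/funext => x; rewrite derive_cst.
exact: IHk.
Qed.

(** The first derivative in direction v is the constant f v, so [Ck_cst] settles all higher
    orders. *)
Lemma smooth_linear (R : realType) m (W : normedModType R) (O : set 'rV[R]_m)
    (f : {linear 'rV[R]_m -> W}) : continuous f -> smooth_on O f.
Proof.
move=> fC [|k]; split=> //; try by move=> x _; exact: fC.
move=> v; split; first by move=> x _; have [] := is_derive_linear f x v.
have -> : (fun x => 'D_v f x) = (fun=> f v).
  by apply/funext => x; have [_] := is_derive_linear f x v.
exact: Ck_cst.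
Qed.

(** * Curvature and nilpotency for the affine connection *)

(** Constant fields commute, so the bracket term drops out, and the covariant derivative of one
    along another is just the Christoffel term. *)
Lemma curvature_atE (R : realType) n (G : christoffel R n) (x u v w : 'rV[R]_n) :
  curvature_at G x u v w =
    'D_u (fun y => christoffel_app G y v w) x
    + christoffel_app G x u (christoffel_app G x v w)
    - ('D_v (fun y => christoffel_app G y u w) x
       + christoffel_app G x v (christoffel_app G x u w)).
Proof.
have covE (a b : 'rV[R]_n) :
    cov_deriv G (cst a) (cst b) = fun y => christoffel_app G y a b.
  by apply/funext => y; rewrite /cov_deriv derive_cst add0r.
rewrite /curvature_at /curvature !covE.
rewrite {3}/cov_deriv /lie_bracket !derive_cst subrr add0r.
suff -> : christoffel_app G x 0 w = 0 by rewrite subr0.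
apply/rowP => k; rewrite !mxE big1// => i _; rewrite big1// => j _.
by rewrite mxE !mul0r.
Qed.

Definition corner_conn (R : realType) n (B : 'M[R]_n.+1) : christoffel R n.+1 :=
  fun x i j k => (i == 0)%:R * (j == 0)%:R * (x *m B) 0 k.

Lemma corner_connE (R : realType) n (B : 'M[R]_n.+1) (x v w : 'rV[R]_n.+1) :
  christoffel_app (corner_conn B) x v w = (v 0 0 * w 0 0) *: (x *m B).
Proof.
apply/rowP => k; rewrite [LHS]mxE [RHS]mxE /corner_conn.
rewrite (bigD1 0)//= [X in _ + X]big1 => [|i /negbTE->]; last first.
  by rewrite big1// => j _; rewrite !mul0r mulr0.
rewrite (bigD1 0)//= [X in _ + X + _]big1 => [|j /negbTE->]; last first.
  by rewrite mulr0 mul0r mulr0.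
by rewrite !mul1r !addr0.
Qed.

Lemma corner_conn_smooth (R : realType) n (B : 'M[R]_n.+1) (O : set 'rV[R]_n.+1)
    i j k : smooth_on O (fun x => corner_conn B x i j k).
Proof.
pose c : R := (i == 0)%:R * (j == 0)%:R.
have lin : linear (fun x : 'rV[R]_n.+1 => c * (x *m B) 0 k : R).
  move=> a u v; rewrite mulmxDl -scalemxAl !mxE mulrDr; congr (_ + _).
  by rewrite mulrCA.
pose f : {linear 'rV[R]_n.+1 -> R} := HB.pack (fun x : 'rV[R]_n.+1 => c * (x *m B) 0 k : R)
  (GRing.isLinear.Build _ _ _ _ _ lin).
apply: (@smooth_linear R n.+1 R O f) => x.
have fE : (f : 'rV[R]_n.+1 -> R) = fun y => \sum_l y 0 l * (c * B l k).
  apply/funext => y; rewrite /= mxE mulr_sumr.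
  by apply: eq_bigr => l _; rewrite mulrCA.
rewrite fE; apply: (@cvg_big _ _ _ _ _ add_continuous _ (nbhs x) _ _ _ (nbhs_filter x)) => l _.
apply: cvgMr_tmp.
exact: coord_continuous.
Qed.

(** Gamma(v, w) is a multiple of x B, whose component 0 vanishes because column 0 of B does. Since
    Gamma only sees components 0, the terms quadratic in Gamma vanish and only the derivatives of
    Gamma remain. *)
Lemma corner_curvature (R : realType) n (B : 'M[R]_n.+1) (x u v w : 'rV[R]_n.+1) :
  (forall i, B i 0 = 0) ->
  curvature_at (corner_conn B) x u v w =
    w 0 0 *: (v 0 0 *: (u *m B) - u 0 0 *: (v *m B)).
Proof.
move=> B0.
have xB0 (y : 'rV_n.+1) : (y *m B) 0 0 = 0 by rewrite mxE big1// => i _; rewrite B0 mulr0.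
have DE (a b c : 'rV[R]_n.+1) :
    'D_a (fun y => christoffel_app (corner_conn B) y b c) x =
    (b 0 0 * c 0 0) *: (a *m B).
  suff [] : is_derive x a (fun y => christoffel_app (corner_conn B) y b c)
    ((b 0 0 * c 0 0) *: (a *m B)) by [].
  apply: (is_derive_cubic (B := 0) (C := 0)) => h.
  by rewrite !corner_connE mulmxDl -scalemxAl scalerDr !scaler0 !addr0 addrC
    !scalerA [h * _]mulrC.
have appapp (a b c : 'rV[R]_n.+1) :
    christoffel_app (corner_conn B) x a (christoffel_app (corner_conn B) x b c) = 0.
  by rewrite !corner_connE [X in _ * X]mxE xB0 !mulr0 scale0r.
rewrite curvature_atE !DE !appapp.
by rewrite !addr0 scalerBr !scalerA [w 0 0 * _]mulrC [w 0 0 * _]mulrC.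
Qed.

Lemma corner_nilpotent (R : realType) n (B : 'M[R]_n.+1) (x X : 'rV[R]_n.+1) :
  (forall i j : 'I_n.+1, (j <= i)%N -> B i j = 0) ->
  nilpotent_op (jacobi (corner_conn B) x X).
Proof.
move=> hB; have B0 i : B i 0 = 0 by exact: hB.
pose f := jacobi (corner_conn B) x X.
have fE Y : f Y = X 0 0 *: (X 0 0 *: (Y *m B) - Y 0 0 *: (X *m B)).
  exact: corner_curvature.
have fj Y j : f Y 0 j = X 0 0 * (X 0 0 * (Y *m B) 0 j - Y 0 0 * (X *m B) 0 j).
  by rewrite fE; move: (Y *m B) (X *m B) => YB XB; rewrite !mxE.
(* Right multiplication by a strictly upper triangular B lengthens the initial run of zero entries
   by one. *)
have mulB (Y : 'rV[R]_n.+1) m : (forall j : 'I_n.+1, (j < m)%N -> Y 0 j = 0) ->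
    forall j : 'I_n.+1, (j <= m)%N -> (Y *m B) 0 j = 0.
  move=> Y0 j jm; rewrite mxE big1// => i _.
  have [ij|ji] := ltnP i j; last by rewrite hB// mulr0.
  by rewrite Y0 ?mul0r// (leq_trans ij).
(* The first application clears entry 0. From then on the factor Y_0 kills the X B term, and each
   further application gains one entry through [mulB]; after m + 1 of them entries 0 to m are
   zero. *)
have key m Y : forall j : 'I_n.+1, (j <= m)%N -> iter m.+1 f Y 0 j = 0.
  elim: m => [|m IHm] j jm; rewrite iterS fj.
    by rewrite (mulB Y 0)// (mulB X 0)// !mulr0 subr0 mulr0.
  by rewrite (mulB _ m.+1)// (IHm 0)// mul0r mulr0 subr0 mulr0.
exists n.+1 => Y; apply/rowP => j; rewrite [RHS]mxE key//.
by rewrite -ltnS.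
Qed.

(** * Bilinear forms on R^n x R^n *)

Lemma scalar_row_sum (R : realType) m (f : 'rV[R]_m -> R) (v : 'rV[R]_m) :
  scalar f -> \sum_i v 0 i * f (delta_mx 0 i) = f v.
Proof.
move=> fl; pose F : {scalar 'rV[R]_m} := HB.pack f (GRing.isLinear.Build _ _ _ _ _ fl).
rewrite -[f]/(F : _ -> _) [in RHS](row_sum_delta v) linear_sum.
by apply: eq_bigr => i _; rewrite linearZ.
Qed.

Definition dot (R : realType) n (u v : 'rV[R]_n) : R := (u *m v^T) 0 0.

Lemma dotE (R : realType) n (u v : 'rV[R]_n) : dot u v = \sum_i u 0 i * v 0 i.
Proof. by rewrite /dot mxE; under eq_bigr do rewrite mxE. Qed.

Lemma dotC (R : realType) n (u v : 'rV[R]_n) : dot u v = dot v u.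
Proof. by rewrite !dotE; apply: eq_bigr => i _; rewrite mulrC. Qed.

(** The shape [a *: u + v] is that of the linearity axiom and of the increment [h *: v + x] in
    [is_derive_cubic]. *)
Lemma dotPl (R : realType) n a (u v w : 'rV[R]_n) :
  dot (a *: u + v) w = a * dot u w + dot v w.
Proof. by rewrite /dot mulmxDl -scalemxAl !mxE. Qed.

Lemma dotPr (R : realType) n a (u v w : 'rV[R]_n) :
  dot w (a *: u + v) = a * dot w u + dot w v.
Proof. by rewrite dotC dotPl !(dotC w). Qed.

Lemma dot0l (R : realType) n (u : 'rV[R]_n) : dot 0 u = 0.
Proof. by rewrite /dot mul0mx mxE. Qed.

Lemma dot0r (R : realType) n (u : 'rV[R]_n) : dot u 0 = 0.
Proof. by rewrite dotC dot0l. Qed.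

Lemma dotZl (R : realType) n a (u v : 'rV[R]_n) : dot (a *: u) v = a * dot u v.
Proof. by rewrite -[a *: u]addr0 dotPl dot0l addr0. Qed.

Lemma dotZr (R : realType) n a (u v : 'rV[R]_n) : dot u (a *: v) = a * dot u v.
Proof. by rewrite dotC dotZl dotC. Qed.

Lemma dot_delta (R : realType) n (u : 'rV[R]_n) i : dot u (delta_mx 0 i) = u 0 i.
Proof.
rewrite dotE (bigD1 i)//= mxE !eqxx mulr1 big1 ?addr0// => j /negbTE ji.
by rewrite mxE eqxx ji mulr0.
Qed.

Lemma lsubmx_delta_l (R : realType) m n (i : 'I_m) :
  lsubmx (delta_mx 0 (lshift n i) : 'rV[R]_(m + n)) = delta_mx 0 i.
Proof. by apply/rowP => j; rewrite !mxE (inj_eq (@lshift_inj _ _)). Qed.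

Lemma lsubmx_delta_r (R : realType) m n (i : 'I_n) :
  lsubmx (delta_mx 0 (rshift m i) : 'rV[R]_(m + n)) = 0.
Proof. by apply/rowP => j; rewrite !mxE eq_lrshift andbF. Qed.

Lemma rsubmx_delta_l (R : realType) m n (i : 'I_m) :
  rsubmx (delta_mx 0 (lshift n i) : 'rV[R]_(m + n)) = 0.
Proof. by apply/rowP => j; rewrite !mxE eq_rlshift andbF. Qed.

Lemma rsubmx_delta_r (R : realType) m n (i : 'I_n) :
  rsubmx (delta_mx 0 (rshift m i) : 'rV[R]_(m + n)) = delta_mx 0 i.
Proof. by apply/rowP => j; rewrite !mxE (inj_eq (@rshift_inj _ _)). Qed.

Definition sub_delta := (lsubmx_delta_l, lsubmx_delta_r, rsubmx_delta_l, rsubmx_delta_r).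

(** For z = (x, x'), [pairing z] is the tautological 1-form x_i' dx^i at z. *)
Definition pairing (R : realType) n (u v : 'rV[R]_(n + n)) : R :=
  dot (rsubmx u) (lsubmx v).

(** On the diagonal this is x_k' Gamma_00^k, the connection term of g_N. *)
Definition bform (R : realType) n (B : 'M[R]_n) (u v : 'rV[R]_(n + n)) : R :=
  dot (rsubmx u) (lsubmx v *m B).

(* The derivative at [z] in the direction [u] of g_N(v, w), which is a constant
   plus half of [hess B z z v w]. *)
Definition hess (R : realType) n (B : 'M[R]_n.+1) (u z v w : 'rV[R]_(n.+1 + n.+1)) : R :=
  pairing u v * pairing z w + pairing z v * pairing u w
  - 2 * (lsubmx v 0 0 * lsubmx w 0 0) * (bform B u z + bform B z u).

Lemma pairingPl (R : realType) n a (u v w : 'rV[R]_(n + n)) :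
  pairing (a *: u + v) w = a * pairing u w + pairing v w.
Proof. by rewrite /pairing linearP dotPl. Qed.

Lemma pairingPr (R : realType) n a (u v w : 'rV[R]_(n + n)) :
  pairing w (a *: u + v) = a * pairing w u + pairing w v.
Proof. by rewrite /pairing linearP dotPr. Qed.

Lemma bformPl (R : realType) n (B : 'M[R]_n) a (u v w : 'rV[R]_(n + n)) :
  bform B (a *: u + v) w = a * bform B u w + bform B v w.
Proof. by rewrite /bform linearP dotPl. Qed.

Lemma bformPr (R : realType) n (B : 'M[R]_n) a (u v w : 'rV[R]_(n + n)) :
  bform B w (a *: u + v) = a * bform B w u + bform B w v.
Proof. by rewrite /bform linearP mulmxDl -scalemxAl dotPr. Qed.

Lemma lsub0P (R : realType) n a (u v : 'rV[R]_(n.+1 + n.+1)) :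
  lsubmx (a *: u + v) 0 0 = a * lsubmx u 0 0 + lsubmx v 0 0.
Proof. by rewrite !mxE. Qed.

Lemma pairingZl (R : realType) n a (u w : 'rV[R]_(n + n)) :
  pairing (a *: u) w = a * pairing u w.
Proof. by rewrite /pairing linearZ dotZl. Qed.

Lemma bformZl (R : realType) n (B : 'M[R]_n) a (u w : 'rV[R]_(n + n)) :
  bform B (a *: u) w = a * bform B u w.
Proof. by rewrite /bform linearZ dotZl. Qed.

Lemma bformZr (R : realType) n (B : 'M[R]_n) a (u w : 'rV[R]_(n + n)) :
  bform B w (a *: u) = a * bform B w u.
Proof. by rewrite /bform linearZ -scalemxAl dotZr. Qed.

Definition formZ := (pairingZl, bformZl, bformZr).

Definition formP := (pairingPl, pairingPr, bformPl, bformPr, lsub0P).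

(** * The Levi-Civita connection of g_N *)

(** One formula for all four blocks: [pairing] and [lsubmx] vanish on the fibre coordinate vectors.
    It displays the Gram matrix as a polynomial in z, ready for [ring] and [field]. *)
Lemma extension_gram (R : realType) n (B : 'M[R]_n.+1) (z : 'rV[R]_(n.+1 + n.+1)) I J :
  riemannian_extension (corner_conn B) z I J =
    block_mx 0 1%:M 1%:M (0 : 'M[R]_n.+1) I J
    + pairing z (delta_mx 0 I) * pairing z (delta_mx 0 J)
    - 2 * (lsubmx (delta_mx 0 I : 'rV[R]_(n.+1 + n.+1)) 0 0
           * lsubmx (delta_mx 0 J : 'rV[R]_(n.+1 + n.+1)) 0 0) * bform B z z.
Proof.
rewrite /pairing /riemannian_extension /bform.
have [i ->|i ->] := split_ordP I; have [j ->|j ->] := split_ordP J;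
  rewrite ?(block_mxEul, block_mxEur, block_mxEdl, block_mxEdr) !sub_delta
    ?dot0r ?dot_delta ?[(0 : 'rV[R]_n.+1) 0 0]mxE ?(mul0r, mulr0) ?subr0 ?addr0 //.
rewrite [(0 : 'M[R]_n.+1) _ _]mxE add0r [LHS]mxE; congr (_ - _).
rewrite -mulrA; congr (_ * _).
rewrite dotE mulr_sumr; apply: eq_bigr => k _; rewrite /corner_conn.
by rewrite mulrCA ![delta_mx _ _ _ _]mxE eqxx /= (eq_sym 0) (eq_sym 0).
Qed.

Lemma partial_extension (R : realType) n (B : 'M[R]_n.+1) (z : 'rV[R]_(n.+1 + n.+1)) I J L :
  partial I (fun y => riemannian_extension (corner_conn B) y J L) z =
    hess B (delta_mx 0 I) z (delta_mx 0 J) (delta_mx 0 L).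
Proof.
pose d K : 'rV[R]_(n.+1 + n.+1) := delta_mx 0 K.
suff [] : is_derive z (d I)
    (fun y => riemannian_extension (corner_conn B) y J L) (hess B (d I) z (d J) (d L)) by [].
(* The Gram matrix is quadratic in z, so its second-order coefficient is half its second derivative
   in direction [d I]. *)
apply: (is_derive_cubic (B := hess B (d I) (d I) (d J) (d L) / 2) (C := 0)) => h.
rewrite scaler0 addr0 !extension_gram -/(d I) -/(d J) -/(d L) /hess !formP.
by rewrite /GRing.scale /=; field.
Qed.

Lemma invmx_block_extension (R : realType) n (A : 'M[R]_n) :
  invmx (block_mx A 1%:M 1%:M 0) = block_mx 0 1%:M 1%:M (- A).
Proof.
set M := block_mx A _ _ _; set N := block_mx _ _ _ _.
have MN : M *m N = 1%:M.
  rewrite mulmx_block !mulmx0 !mul1mx !mulmx1 !mul0mx !add0r addr0 subrr.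
  by rewrite -scalar_mx_block.
have [uM _] := mulmx1_unit MN.
by rewrite -[RHS](mulKmx uM) MN mulmx1.
Qed.

(* Twice the Christoffel symbols of the first kind, contracted with [v] and [w]. *)
Definition koszul (R : realType) n (B : 'M[R]_n.+1) (z v w : 'rV[R]_(n.+1 + n.+1)) :
    'rV[R]_(n.+1 + n.+1) :=
  \row_L (hess B v z w (delta_mx 0 L) + hess B w z v (delta_mx 0 L)
          - hess B (delta_mx 0 L) z v w).

Lemma koszulZ (R : realType) n (B : 'M[R]_n.+1) a (z v w : 'rV[R]_(n.+1 + n.+1)) :
  koszul B (a *: z) v w = a *: koszul B z v w.
Proof.
by apply/rowP => L; rewrite !mxE /hess !formZ; ring.
Qed.

(** [partial_extension] gives the Koszul formula on coordinate vectors. It is linear in v and in w,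
    so [scalar_row_sum], applied to each, collapses the sums over coordinates. *)
Lemma levi_civita_app (R : realType) n (B : 'M[R]_n.+1) (z v w : 'rV[R]_(n.+1 + n.+1)) :
  let g := riemannian_extension (corner_conn B) in
  christoffel_app (levi_civita g) z v w = 2^-1 *: (koszul B z v w *m (invmx (g z))^T).
Proof.
move=> g; apply/rowP => K; rewrite [LHS]mxE [RHS]mxE [X in _ = _ * X]mxE mulr_sumr.
pose d I : 'rV[R]_(n.+1 + n.+1) := delta_mx 0 I.
pose k L v w := hess B v z w (d L) + hess B w z v (d L) - hess B (d L) z v w.
have kE L : k L v w = \sum_I \sum_J v 0 I * w 0 J * k L (d I) (d J).
  rewrite -(@scalar_row_sum _ _ (fun v => k L v w)) => [|a x y]; last first.
    by rewrite /k /hess !formP /GRing.scale /=; ring.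
  apply: eq_bigr => I _.
  rewrite -(@scalar_row_sum _ _ (k L (delta_mx 0 I))) => [|a x y]; last first.
    by rewrite /k /hess !formP /GRing.scale /=; ring.
  by rewrite mulr_sumr; apply: eq_bigr => J _; rewrite mulrA.
under [RHS]eq_bigr => L _.
  rewrite [koszul B z v w 0 L]mxE -/(d L) -/(k L v w) kE [X in 2^-1 * (_ * X)]mxE.
  rewrite mulr_suml mulr_sumr.
  under eq_bigr do rewrite mulr_suml mulr_sumr.
  over.
rewrite [RHS]exchange_big; apply: eq_bigr => I _; rewrite [RHS]exchange_big.
apply: eq_bigr => J _; rewrite /levi_civita !mulr_sumr; apply: eq_bigr => L _.
by rewrite !partial_extension -!/(d _) /k; ring.
Qed.

(* The cubic term comes from the inverse metric, which is a constant plus a term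
   quadratic in [h]. *)
Lemma levi_civita_scale (R : realType) n (B : 'M[R]_n.+1) h (u v w : 'rV[R]_(n.+1 + n.+1)) :
  let g := riemannian_extension (corner_conn B) in
  let k := koszul B u v w in
  christoffel_app (levi_civita g) (h *: u) v w =
    h *: (2^-1 *: row_mx (rsubmx k) (lsubmx k))
    + h ^+ 3 *: (2^-1 *: row_mx 0 (- rsubmx k *m (ulsubmx (g u))^T)).
Proof.
move=> g k.
have gE z : g z = block_mx (ulsubmx (g z)) 1%:M 1%:M 0.
  by rewrite -[g z in LHS]submxK /g /riemannian_extension block_mxKur block_mxKdl block_mxKdr.
have gZ : ulsubmx (g (h *: u)) = h ^+ 2 *: ulsubmx (g u).
  have ulE (A : 'M[R]_(n.+1 + n.+1)) i j :
      ulsubmx A i j = A (lshift n.+1 i) (lshift n.+1 j) by rewrite !mxE.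
  apply/matrixP => i j; rewrite [RHS]mxE !ulE /g !extension_gram !block_mxEul [(0 : 'M[R]_n.+1) _ _]mxE.
  by rewrite !formZ; ring.
rewrite levi_civita_app -/g koszulZ -/k (gE (h *: u)) invmx_block_extension gZ.
rewrite tr_block_mx !trmx1 trmx0 -[k in LHS]hsubmxK scale_row_mx mul_row_block.
rewrite !mulmx0 !mulmx1 add0r !scale_row_mx add_row_mx; congr row_mx.
  by rewrite !scaler0 addr0 !scalerA mulrC.
rewrite linearN /= linearZ /= mulmxN mulNmx -scalemxAl -scalemxAr !scalerDr !scalerN !scalerA.
congr (_ *: _ - _ *: _); ring.
Qed.

(** * Jacobi operators at the origin of T*M *)

(** The Christoffel symbols vanish at the origin, so the curvature there is the antisymmetrized
    linear part found in [levi_civita_scale]. Exchanging the two halves of k is the action of the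
    inverse Gram matrix at the origin. *)
Lemma extension_jacobi (R : realType) n (B : 'M[R]_n.+1) (xi eta : 'rV[R]_(n.+1 + n.+1)) :
  let k := koszul B eta xi xi - koszul B xi eta xi in
  jacobi (levi_civita (riemannian_extension (corner_conn B))) 0 xi eta =
    2^-1 *: row_mx (rsubmx k) (lsubmx k).
Proof.
move=> k; pose g := riemannian_extension (corner_conn B).
have G0 v w : christoffel_app (levi_civita g) 0 v w = 0.
  by rewrite -(scale0r 0) levi_civita_scale expr0n /= !scale0r addr0.
have DE a b c : 'D_a (fun y => christoffel_app (levi_civita g) y b c) 0 =
    2^-1 *: row_mx (rsubmx (koszul B a b c)) (lsubmx (koszul B a b c)).
  suff [] : is_derive 0 a (fun y => christoffel_app (levi_civita g) y b c)
    (2^-1 *: row_mx (rsubmx (koszul B a b c)) (lsubmx (koszul B a b c))) by [].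
  apply: (is_derive_cubic (B := 0) 
    (C := 2^-1 *: row_mx 0 (- rsubmx (koszul B a b c) *m (ulsubmx (g a))^T))) => h.
  by rewrite G0 scaler0 !addr0 add0r levi_civita_scale.
rewrite /jacobi curvature_atE !DE !G0 !addr0 -scalerBr.
by rewrite opp_row_mx add_row_mx -!linearB.
Qed.

Lemma dot_delta_l (R : realType) n (u : 'rV[R]_n) i : dot (delta_mx 0 i) u = u 0 i.
Proof. by rewrite dotC dot_delta. Qed.

Lemma dot_row (R : realType) n (B : 'M[R]_n) (u : 'rV[R]_n) i :
  dot u (row i B) = (u *m B^T) 0 i.
Proof. by rewrite dotE mxE; apply: eq_bigr => j _; rewrite !mxE. Qed.

(** At the origin g_N((x, x'), (x, x')) = 2 x.x', so the factor 1/2 makes the vector unit. *)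
Definition diag_vec (R : realType) n (k : 'I_n) : 'rV[R]_(n + n) :=
  row_mx (delta_mx 0 k) (2^-1 *: delta_mx 0 k).

(** In [hess B u z v w] the matrix B comes with the factor v_0 w_0. If k <> 0, this leaves only a
    multiple of B_kk = 0. If k = 0, the zero row and column of B leave only the term of
    [koszul B eta xi xi] differentiated along coordinate vectors, which contributes y B and y'
    B^T. *)
Lemma extension_jacobi_diag (R : realType) n (B : 'M[R]_n.+1) (k : 'I_n.+1)
    (y y' : 'rV[R]_n.+1) :
  (forall j, B 0 j = 0) -> (forall i, B i 0 = 0) -> B k k = 0 ->
  jacobi (levi_civita (riemannian_extension (corner_conn B))) 0 (diag_vec R k) (row_mx y y') =
  row_mx
    (4^-1 *: y + (4^-1 * y 0 k - y' 0 k) *: delta_mx 0 k + (k == 0)%:R *: (y *m B))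
    (4^-1 *: y' + (4^-1 * y' 0 k - 4^-1 * y 0 k) *: delta_mx 0 k
     + (k == 0)%:R *: (y' *m B^T)).
Proof.
move=> Br Bc Bk.
have row0 : row 0 B = 0 by apply/rowP => j; rewrite !mxE Br.
have yB0 : (y *m B) 0 0 = 0 by rewrite mxE big1// => i _; rewrite Bc mulr0.
have y'B0 : (y' *m B^T) 0 0 = 0 by rewrite mxE big1// => i _; rewrite mxE Br mulr0.
(* These equations expand one entry at a time, keeping the products with B and B^T as atoms for
   [field]. *)
have combE a b c (u v w : 'rV[R]_n.+1) i :
    (a *: u + b *: v + c *: w) 0 i = a * u 0 i + b * v 0 i + c * w 0 i by rewrite !mxE.
have z0 i : (0 : 'rV[R]_n.+1) 0 i = 0 by rewrite mxE.
have ekk : (delta_mx 0 k : 'rV[R]_n.+1) 0 k = 1 by rewrite mxE !eqxx.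
have ek0 : k != 0 -> (delta_mx 0 k : 'rV[R]_n.+1) 0 0 = 0.
  by move=> /negbTE k0; rewrite mxE eq_sym k0.
have rowi0 i : row i B 0 0 = 0 by rewrite mxE.
have halfE (a : R) (u : 'rV[R]_n.+1) i : (a *: u) 0 i = a * u 0 i by rewrite mxE.
have rowkk : row k B 0 k = 0 by rewrite mxE.
have koszulBE a b c d e f L : (koszul B a b c - koszul B d e f) 0 L =
    hess B b a c (delta_mx 0 L) + hess B c a b (delta_mx 0 L) - hess B (delta_mx 0 L) a b c
    - (hess B e d f (delta_mx 0 L) + hess B f d e (delta_mx 0 L)
       - hess B (delta_mx 0 L) d e f) by rewrite !mxE.
rewrite extension_jacobi scale_row_mx; congr row_mx; apply/rowP => i;
  rewrite [LHS]mxE combE [X in _ * X]mxE koszulBE /hess /pairing /bform /diag_vec;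
  rewrite !row_mxKl !row_mxKr !sub_delta -!rowE;
  rewrite !(dotZl, dot_delta, dot_delta_l, dot0l, dot0r, dot_row, mul0mx) ?z0 ?halfE ekk ?rowkk.
all: have [k0|k0] := eqVneq k 0; rewrite ?mulr1n ?mulr0n.
- by rewrite k0 in ekk *; rewrite ekk row0 yB0 y'B0 ?z0; field.
- by rewrite ek0//; field.
- by rewrite k0 in ekk *; rewrite ekk yB0 y'B0 rowi0; field.
- by rewrite ek0//; field.
Qed.

(** * The affine manifold *)

(** A single global chart, the identity. The definition is transparent, so charts and transition
    maps reduce to [id] later on. *)
Definition euclidean_manifold (R : realType) n : manifold R n.
Proof.
apply: (@Manifold R n 'rV[R]_n unit (fun=> setT) (fun=> id) (fun=> id)) => //.
- exact: second_countable_rV.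
- by move=> _; exact: openT.
- by move=> _; rewrite image_id; exact: openT.
- by move=> _ p _; exact: cvg_id.
- by move=> _ x _; exact: cvg_id.
- by move=> _ _; apply: (@smooth_linear R n 'rV[R]_n _ idfun) => x; exact: cvg_id.
Defined.

Definition corner_connection (R : realType) n (B : 'M[R]_n.+1) :
  torsion_free_connection (euclidean_manifold R n.+1).
Proof.
apply: (@TorsionFreeConnection _ _ (euclidean_manifold R n.+1) (fun=> corner_conn B)).
- by move=> a i j k; exact: corner_conn_smooth.
- by move=> a x i j k _; rewrite /corner_conn (mulrC (i == 0)%:R).
- move=> a b p _ _ t x u v.
  have tE : t = id by [].
  rewrite tE !derive_id; under eq_fun do rewrite derive_id.
  by rewrite derive_cst add0r.
Defined.

(** * Bases, unit vectors and diagonalization *)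

(** The basis is kept as the rows of E, while [represented_by] puts images in columns, hence the
    transpose. The equation [m = N] is a hypothesis because 1 + (1 + (r + r)) and r.+1 + r.+1 are
    not convertible. *)
Lemma represented_by_row (R : realType) m N (E : 'M[R]_(m, N)) f A :
  m = N -> row_full E -> (forall j, f (row j E) = row j (A^T *m E)) ->
  represented_by (fun i => row i E) f A.
Proof.
move=> mN fullE fE; have EE : \matrix_i row i E = E.
  by apply/row_matrixP => i; rewrite rowK.
split; rewrite ?EE//.
  by move/eqP: fullE => rE; rewrite /row_free rE mN.
move=> j; rewrite fE rowE mulmxA -rowE mulmx_sum_row.
by apply: eq_bigr => i _; rewrite !mxE.
Qed.

(** The sum and the difference of (2 e_k, e_k) and (2 e_k, - e_k) are 4 (e_k, 0) and 2 (0, e_k),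
    which supplies the two missing coordinate vectors. *)
Lemma row_full_hyperbolic (R : realType) m n (E : 'M[R]_(m, n + n)) (k : 'I_n) :
  let e i : 'rV[R]_n := delta_mx 0 i in
  (row_mx (2 *: e k) (e k) <= E)%MS -> (row_mx (2 *: e k) (- e k) <= E)%MS ->
  (forall i, i != k -> (row_mx (e i) 0 <= E)%MS /\ (row_mx 0 (e i) <= E)%MS) ->
  row_full E.
Proof.
move=> e Ep Em Ei; rewrite -sub1mx; apply/row_subP => I; rewrite row1.
have [i ->|i ->] := split_ordP I; rewrite -[delta_mx _ _]hsubmxK !sub_delta.
- have [->|/Ei[]//] := eqVneq i k.
  have -> : row_mx (delta_mx 0 k) 0 =
      4^-1 *: (row_mx (2 *: e k) (e k) + row_mx (2 *: e k) (- e k)).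
    rewrite add_row_mx subrr scale_row_mx scaler0 -scalerDl scalerA.
    by rewrite (_ : 4^-1 * _ = 1) ?scale1r//; field.
  by rewrite scalemx_sub// addmx_sub.
- have [->|/Ei[]//] := eqVneq i k.
  have -> : row_mx 0 (delta_mx 0 k) =
      2^-1 *: (row_mx (2 *: e k) (e k) - row_mx (2 *: e k) (- e k)).
    rewrite opp_row_mx add_row_mx subrr scale_row_mx scaler0 opprK -{2}[e k]scale1r.
    rewrite -[X in _ *: (X + _)]scale1r -scalerDl scalerA.
    by rewrite (_ : 2^-1 * _ = 1) ?scale1r//; field.
  by rewrite scalemx_sub// addmx_sub// -scaleN1r scalemx_sub.
Qed.

Lemma diag_vec_unit (R : realType) n (B : 'M[R]_n.+1) k :
  unit_spacelike (riemannian_extension (corner_conn B)) 0 (diag_vec R k).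
Proof.
have g0 : riemannian_extension (corner_conn B) 0 = block_mx 0 1%:M 1%:M 0.
  apply/matrixP => I J; rewrite extension_gram.
  by rewrite /pairing /bform !linear0 !dot0l !mul0r mulr0 addr0 subr0.
rewrite /unit_spacelike /= g0; set S := block_mx _ _ _ _; set xi := diag_vec R k.
have -> : \sum_i \sum_j S i j * xi 0 i * xi 0 j = (xi *m S *m xi^T) 0 0.
  rewrite mxE exchange_big; apply: eq_bigr => j _.
  rewrite [X in _ = X * _]mxE [X in _ = _ * X]mxE mulr_suml.
  by apply: eq_bigr => i _; rewrite (mulrC (S i j)).
rewrite mul_row_block !mulmx0 !mulmx1 add0r addr0 tr_row_mx mul_row_col.
by rewrite mxE -!/(dot _ _) dotZl dotZr dot_delta mxE !eqxx /=; field.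
Qed.

(** The cases c = 1 and c = -1 give the eigenvectors for 0 and 1: the first is twice xi, the second
    is g_N-orthogonal to xi. The B terms vanish, by their factor if k <> 0 and by the zero row and
    column of B if k = 0. *)
Lemma extension_jacobi_plane (R : realType) n (B : 'M[R]_n.+1) (k : 'I_n.+1) (c : R) :
  (forall j, B 0 j = 0) -> (forall i, B i 0 = 0) -> B k k = 0 ->
  let e : 'rV[R]_n.+1 := delta_mx 0 k in
  jacobi (levi_civita (riemannian_extension (corner_conn B))) 0 (diag_vec R k)
    (row_mx (2 *: e) (c *: e)) = ((1 - c) / 2) *: row_mx (2 *: e) (- e).
Proof.
move=> Br Bc Bk e; rewrite extension_jacobi_diag// -!scalemxAl.
have tB a : (k == 0)%:R *: (a *: (e *m B)) = 0.
  have [k0|] := eqVneq k 0; last by rewrite scale0r.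
  by rewrite /e k0 -rowE (_ : row 0 B = 0) ?scaler0 ?scaler0//; apply/rowP => j; rewrite !mxE Br.
have tB' a : (k == 0)%:R *: (a *: (e *m B^T)) = 0.
  have [k0|] := eqVneq k 0; last by rewrite scale0r.
  by rewrite /e k0 -rowE (_ : row 0 B^T = 0) ?scaler0 ?scaler0//; apply/rowP => j; rewrite !mxE Bc.
rewrite tB tB' !addr0.
rewrite ![(_ *: e) 0 k]mxE !mxE !eqxx /= !mulr1 !scalerA -!scalerDl.
by rewrite scale_row_mx scalerN -scaleNr scalerA; congr row_mx; congr (_ *: _); field.
Qed.

Lemma extension_diagonalizable (R : realType) n (B : 'M[R]_n.+1) (k : 'I_n.+1) :
  (forall j, B 0 j = 0) -> (forall i, B i 0 = 0) -> B k k = 0 -> k != 0 ->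
  diagonalizable_op
    (jacobi (levi_civita (riemannian_extension (corner_conn B))) 0 (diag_vec R k)).
Proof.
move=> Br Bc Bk k0; pose e i : 'rV[R]_n.+1 := delta_mx 0 i.
(* An eigenbasis: coordinate vectors with eigenvalue 1/4, except that those of index k are replaced
   by the eigenvectors for 0 and 1. *)
pose P := \matrix_i (if i == k then row_mx (2 *: e k) (e k) else row_mx (e i) 0).
pose Q := \matrix_i (if i == k then row_mx (2 *: e k) (- e k) else row_mx 0 (e i)).
pose d := row_mx (\row_i (if i == k then 0 else 4^-1 : R))
                 (\row_i (if i == k then 1 else 4^-1 : R)).
exists (fun i => row i (col_mx P Q)), d; apply: represented_by_row => //.
  have rP i : (row i P <= col_mx P Q)%MS.
    by have := row_sub (lshift _ i) (col_mx P Q); rewrite rowKu.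
  have rQ i : (row i Q <= col_mx P Q)%MS.
    by have := row_sub (rshift _ i) (col_mx P Q); rewrite rowKd.
  apply: (@row_full_hyperbolic _ _ _ _ k) => [||i /negbTE ik].
  - by have := rP k; rewrite rowK eqxx.
  - by have := rQ k; rewrite rowK eqxx.
  - by have := rP i; have := rQ i; rewrite !rowK ik.
move=> I; have -> : row I ((diag_mx d)^T *m col_mx P Q) = d 0 I *: row I (col_mx P Q).
  by apply/rowP => j; rewrite tr_diag_mx mul_diag_mx !mxE.
have deltai i : i != k -> e i 0 k = 0 by rewrite mxE eq_sym => /negbTE ->; rewrite andbF.
have [i ->|i ->] := split_ordP I.
- rewrite rowKu rowK row_mxEl mxE; have [_|ik] := eqVneq i k.
    by rewrite -[X in row_mx _ X]scale1r extension_jacobi_plane// subrr mul0r !scale0r.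
  rewrite extension_jacobi_diag// (negbTE k0) deltai// mxE !mulr0 subrr !scale0r !addr0.
  by rewrite scaler0 scale_row_mx scaler0.
- rewrite rowKd rowK row_mxEr mxE; have [_|ik] := eqVneq i k.
    rewrite -[X in row_mx _ X]scaleN1r extension_jacobi_plane// opprK scaleN1r.
    by rewrite (_ : (1 + 1) / 2 = 1)//; field.
  rewrite extension_jacobi_diag// (negbTE k0) deltai// mxE !mulr0 subrr !scale0r !addr0.
  by rewrite scaler0 scale_row_mx scaler0.
Qed.

(** * The block form and the conclusion *)

(** The transpose makes the matrix strictly upper triangular. It also makes right multiplication on
    rows have matrix U once images are written as columns. *)
Definition corner_mx (R : realType) r (U : 'M[R]_r) : 'M[R]_r.+1 :=
  block_mx (0 : 'M[R]_1) 0 0 U^T.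

Lemma corner_mx_upper (R : realType) r (U : 'M[R]_r) :
  (forall i j : 'I_r, (i <= j)%N -> U i j = 0) ->
  forall i j : 'I_r.+1, (j <= i)%N -> corner_mx U i j = 0.
Proof.
move=> hU i j; have [i' ->|i' ->] := @split_ordP 1 r i;
  have [j' ->|j' ->] := @split_ordP 1 r j; rewrite /corner_mx.
- by rewrite (block_mxEul (0 : 'M[R]_1)) mxE.
- by rewrite (block_mxEur (0 : 'M[R]_1)) mxE.
- by rewrite (block_mxEdl (0 : 'M[R]_1)) mxE.
- by rewrite (block_mxEdr (0 : 'M[R]_1)) mxE /= leq_add2l => /hU.
Qed.

Lemma corner_mx_row0 (R : realType) r (U : 'M[R]_r) j : corner_mx U 0 j = 0.
Proof.
have -> : (0 : 'I_r.+1) = lshift r (0 : 'I_1) by exact: val_inj.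
have [j' ->|j' ->] := @split_ordP 1 r j; rewrite /corner_mx.
- by rewrite (block_mxEul (0 : 'M[R]_1)) mxE.
- by rewrite (block_mxEur (0 : 'M[R]_1)) mxE.
Qed.

Lemma extension_block_form (R : realType) r (U : 'M[R]_r) :
  (forall i j : 'I_r, (i <= j)%N -> U i j = 0) ->
  exists e : 'I_(1 + (1 + (r + r))) -> 'rV[R]_(r.+1 + r.+1),
    represented_by e
      (jacobi (levi_civita (riemannian_extension (corner_conn (corner_mx U)))) 0
         (diag_vec R 0))
      (block4_mx (0%:M : 'M[R]_1) (1%:M : 'M[R]_1) ((4^-1)%:M + U) ((4^-1)%:M + U^T)).
Proof.
move=> hU; set B := corner_mx U.
have Br j : B 0 j = 0 by exact: corner_mx_row0.
have Bc i : B i 0 = 0 by exact: corner_mx_upper.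
have Bd : B 0 0 = 0 by [].
pose e0 : 'rV[R]_r.+1 := delta_mx 0 0.
(* The rows of S are e_1, ..., e_r; S intertwines B with U^T and B^T with U. *)
pose S : 'M[R]_(r, r.+1) := row_mx (0 : 'M[R]_(r, 1)) 1%:M.
have SB : S *m B = U^T *m S.
  (* Restated over 1 + r, convertible to r.+1, so that the block product rules apply. *)
  have: row_mx (0 : 'M[R]_(r, 1)) 1%:M *m block_mx (0 : 'M[R]_1) 0 0 U^T =
      U^T *m row_mx (0 : 'M[R]_(r, 1)) 1%:M; last exact.
  by rewrite mul_row_block mul_mx_row !mulmx0 mul1mx mulmx1 !add0r.
have SBT : S *m B^T = U *m S.
  have: row_mx (0 : 'M[R]_(r, 1)) 1%:M *m (block_mx (0 : 'M[R]_1) 0 0 U^T)^T =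
      U *m row_mx (0 : 'M[R]_(r, 1)) 1%:M; last exact.
  rewrite tr_block_mx mul_row_block mul_mx_row !trmx0 trmxK.
  by rewrite !mulmx0 mul1mx mulmx1 !add0r.
have rowSB i : row i S *m B = row i U^T *m S by rewrite -!row_mul SB.
have rowSBT i : row i S *m B^T = row i U *m S by rewrite -!row_mul SBT.
have rowS i : row i S = delta_mx 0 (lift 0 i).
  have -> : lift 0 i = rshift 1 i :> 'I_r.+1 by exact: val_inj.
  have: row i (row_mx (0 : 'M[R]_(r, 1)) 1%:M) = delta_mx 0 (rshift 1 i); last exact.
  by rewrite row_row_mx row1 linear0 -[RHS]hsubmxK !sub_delta.
have S0 i : row i S 0 0 = 0 by rewrite rowS mxE.
pose C : 'M[R]_(r, r.+1 + r.+1) := row_mx S 0.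
pose D : 'M[R]_(r, r.+1 + r.+1) := row_mx 0 S.
pose p := row_mx (2 *: e0) e0; pose m := row_mx (2 *: e0) (- e0).
(* In the order of the blocks: the eigenvectors for 0 and 1, then (e_i, 0), then (0, e_i), for i >=
   1. *)
pose E := col_mx p (col_mx m (col_mx C D)).
exists (fun i => row i E); apply: represented_by_row.
- by rewrite !add1n addnS.
- have upE m1 m2 (X : 'M[R]_(m1, _)) (Y : 'M[R]_(m2, r.+1 + r.+1)) :
      (X <= col_mx X Y)%MS by rewrite -addsmxE addsmxSl.
  have downE m1 m2 (X : 'M[R]_(m1, _)) (Y : 'M[R]_(m2, r.+1 + r.+1)) :
      (Y <= col_mx X Y)%MS by rewrite -addsmxE addsmxSr.
  have mE : (m <= E)%MS := submx_trans (upE _ _ _ _) (downE _ _ _ _).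
  have CDE : (col_mx C D <= E)%MS := submx_trans (downE _ _ _ _) (downE _ _ _ _).
  apply: (@row_full_hyperbolic _ _ _ _ 0) => [||i]; [exact: upE|exact: mE|].
  case: (unliftP 0 i) => [i'|] ->; last by rewrite eqxx.
  move=> _; rewrite -rowS.
  split; apply: submx_trans CDE.
    by apply: submx_trans (upE _ _ _ _); have := row_sub i' C; rewrite row_row_mx linear0.
  by apply: submx_trans (downE _ _ _ _); have := row_sub i' D; rewrite row_row_mx linear0.
have -> : (block4_mx (0%:M : 'M[R]_1) (1%:M : 'M[R]_1) ((4^-1)%:M + U) ((4^-1)%:M + U^T))^T *m E
    = col_mx 0 (col_mx m (col_mx (4^-1 *: C + U^T *m C) (4^-1 *: D + U *m D))).
  rewrite /block4_mx !tr_block_mx !trmx0 /E !mul_block_col !mul0mx !add0r !addr0.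
  rewrite !linearD /= !tr_scalar_mx trmxK raddf0 mul0mx mul1mx !mulmxDl.
  by rewrite !mul_scalar_mx.
move=> j; have [i ->|j1 ->] := split_ordP j; rewrite /E /p /m.
  rewrite !rowKu !row_id -[X in row_mx _ X]scale1r extension_jacobi_plane//.
  by rewrite subrr mul0r scale0r.
rewrite !rowKd; have [i ->|j2 ->] := split_ordP j1.
  rewrite !rowKu !row_id -[X in row_mx _ X]scaleN1r extension_jacobi_plane//.
  by rewrite opprK (_ : (1 + 1) / 2 = 1) ?scale1r ?scaleN1r//; field.
rewrite !rowKd; have [i ->|i ->] := split_ordP j2; rewrite ?rowKu ?rowKd.
- rewrite linearD linearZ /= row_mul /C !row_row_mx linear0.
  rewrite extension_jacobi_diag// S0 mxE !mulr0 subrr !scale0r !addr0 scaler0 mul0mx scaler0.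
  by rewrite scale1r rowSB mul_mx_row mulmx0 scale_row_mx scaler0 add_row_mx addr0.
- rewrite linearD linearZ /= row_mul /D !row_row_mx linear0.
  rewrite extension_jacobi_diag// S0 mxE !mulr0 subrr !scale0r !addr0 scaler0 mul0mx scaler0.
  by rewrite scale1r rowSBT mul_mx_row mulmx0 scale_row_mx scaler0 add_row_mx addr0.
Qed.

Theorem theorem1p4 (R : realType) (r : nat) (U : 'M[R]_r)
    (hr : (2 <= r)%N)
    (hU : forall i j : 'I_r, (i <= j)%N -> U i j = 0) :
  exists (M : manifold R r.+1) (D : torsion_free_connection M),
    affine_osserman D /\
    exists (p : M) (a : atlas M), chart_dom a p /\
    let Q := zero_section a p in
    let g := riemannian_extension (D a) in
    let J := jacobi (levi_civita g) Q in
    exists xi1 xi2 : 'rV[R]_(r.+1 + r.+1),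
      [/\ unit_spacelike g Q xi1,
          unit_spacelike g Q xi2,
          diagonalizable_op (J xi1) &
          exists e : 'I_(1 + (1 + (r + r))) -> 'rV[R]_(r.+1 + r.+1),
            represented_by e (J xi2)
              (block4_mx (0%:M : 'M[R]_1) (1%:M : 'M[R]_1)
                 ((4^-1)%:M + U) ((4^-1)%:M + U^T))].
Proof.
pose B := corner_mx U; have Bu := corner_mx_upper hU.
exists (euclidean_manifold R r.+1), (corner_connection B); split.
  by move=> a p _ X; exact: corner_nilpotent.
exists (0 : 'rV[R]_r.+1), tt; split=> //.
have -> : @zero_section R r.+1 (euclidean_manifold R r.+1) tt (0 : 'rV[R]_r.+1) = 0.
  exact: row_mx0.
(* For xi1 any index k <> 0 removes B from the Jacobi operator, and [ord_max] is nonzero since r >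
   0; for xi2 the index 0 brings B in. *)
move=> Q g J; exists (diag_vec R ord_max), (diag_vec R 0); split.
- exact: diag_vec_unit.
- exact: diag_vec_unit.
- apply: extension_diagonalizable; first exact: corner_mx_row0.
  + by move=> i; exact: Bu.
  + exact: Bu.
  + by rewrite -val_eqE /= -lt0n ltnW.
- exact: extension_block_form.
Qed.
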